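(* Let $\mu$ be a nontrivial compactly supported probability measure on $\mathbb{R}$. Suppose $I$ is a closed interval on which $\mu$ is purely absolutely continuous, $d\mu=w\,dx$ on $I$, with $$0<w_-\equiv\min_{x\in I}w(x)\le\max_{x\in I}w(x)\equiv w_+<\infty .$$ Then for any $E\in I^{\mathrm{int}}$, $$\limsup_{n\to\infty}\ n\bigl[z_n^{(1)}(E)-z_n^{(-1)}(E)\bigr]\ \le\ 4\pi\,d(E)\,\lim_{\delta\downarrow0}\frac{\max\{w(x):|x-E|<\delta\}}{\min\{w(x):|x-E|<\delta\}} .$$ In particular, if $E$ is a point of continuity of $w$, then $$\limsup_{n\to\infty}\ n\bigl[z_n^{(1)}(E)-z_n^{(-1)}(E)\bigr]\le4\pi\,d(E),$$ independently of the value of $w(E)$.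
   Context: Nontrivial means not supported on a finite set. $p_n$ are the orthonormal polynomials of $\mu$ ($\deg p_n=n$). $E_+=\sup\operatorname{supp}(\mu)$, $E_-=\inf\operatorname{supp}(\mu)$, and $d(E)=\max(E_+-E,\,E-E_-)$ for $E\in[E_-,E_+]$. $z_n^{(-1)}(E)$ is the largest zero of $p_n$ that is $\le E$ and $z_n^{(1)}(E)$ the smallest zero of $p_n$ that is $>E$ (these exist for $n$ large since $E$ lies in the interior of $\operatorname{supp}(\mu)$). *)

(* Defs.v *)
From HB Require Import structures.
From mathcomp Require Export all_boot all_order all_algebra.
From mathcomp Require Export all_classical all_reals all_analysis.
Set Implicit Arguments.
Unset Strict Implicit.
Unset Printing Implicit Defensive.
Import Order.TTheory GRing.Theory Num.Theory.
Import numFieldNormedType.Exports.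
Local Open Scope classical_set_scope.
Local Open Scope ring_scope.

Definition msupp (R : realType) (mu : probability (measurableTypeR R) R)
    : set R :=
  [set x | forall U : set R, open U -> U x -> (0 < mu U)%E].

Definition compactly_supported (R : realType)
    (mu : probability (measurableTypeR R) R) : Prop :=
  compact (msupp mu).

Definition nontrivial_measure (R : realType)
    (mu : probability (measurableTypeR R) R) : Prop :=
  ~ exists A : set R, finite_set A /\ mu (~` A) = 0%E.

(* The sign of the leading coefficient is not normalized: the zeros do not
   depend on it. *)
Definition orthonormal_polys (R : realType)
    (mu : probability (measurableTypeR R) R) (p : nat -> {poly R}) : Prop :=
  (forall n, size (p n) = n.+1) /\
  (forall m n, (\int[mu]_x (((p m).[x] * (p n).[x])%:E) =
                ((m == n)%:R : R)%:E)%E).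

(* [d\mu = w dx] on [[a, b]]; [w] is only relevant on [[a, b]]. *)
Definition has_density_on (R : realType)
    (mu : probability (measurableTypeR R) R) (a b : R) (w : R -> R) : Prop :=
  measurable_fun `[a, b]%classic w /\
  forall A : set R, measurable A -> A `<=` `[a, b]%classic ->
    (mu A = \int[@lebesgue_measure R]_(x in A) (w x)%:E)%E.

Definition dist_ends (R : realType) (mu : probability (measurableTypeR R) R)
    (E : R) : R :=
  Num.max (sup (msupp mu) - E) (E - inf (msupp mu)).

(* [zero_le q E] is the largest zero of [q] in ]-oo, E], and [zero_gt q E] the
   smallest one in ]E, +oo[; both default to 0 if there is no such zero. *)
Definition zero_le (R : realType) (q : {poly R}) (E : R) : R :=
  let Z := [set z | root q z /\ z <= E] in xget 0 (Z `&` ubound Z).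

Definition zero_gt (R : realType) (q : {poly R}) (E : R) : R :=
  let Z := [set z | root q z /\ E < z] in xget 0 (Z `&` lbound Z).

(* The extrema over the open interval need not be attained, hence [sup] and
   [inf]. *)
Definition osc_ratio (R : realType) (w : R -> R) (E delta : R) : R :=
  sup [set w x | x in [set x | `|x - E| < delta]] /
  inf [set w x | x in [set x | `|x - E| < delta]].

Definition limsup_gap (R : realType) (p : nat -> {poly R}) (E : R) : \bar R :=
  limn_esup (fun n => (n%:R * (zero_gt (p n) E - zero_le (p n) E))%:E).

(* Main.v *)
Require Import Defs.
From mathcomp Require Import measurable_realfun.
From mathcomp Require Import ring lra zify.
Import Order.TTheory GRing.Theory Num.Theory.
Import numFieldNormedType.Exports.
Set Implicit Arguments.
Unset Strict Implicit.
Unset Printing Implicit Defensive.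
Local Open Scope classical_set_scope.
Local Open Scope ring_scope.

(** Every interval of length [C / n] around [E] contains a zero of [p n] as
    soon as [C] exceeds the claimed bound and [n] is large; both neighbouring
    zeros then exist and their distance is at most [C / n].

    To find a zero in [`]u, v[], put [c] at the middle and [h] at half the
    length.  The integral of a polynomial of degree at most [2 n - 1] against
    [mu] is a combination, with nonnegative weights, of its values at the zeros
    of [p n] (Gauss quadrature).  So if [p n] had no zero in the interval, then
    [((x - c)^2 - h^2) Q(x)^2], which is nonnegative outside it, would have a
    nonnegative integral ([quadrature_ge0]).  It is therefore enough to produce
    one polynomial [Q] of degree at most [n - 2] whose mass sits so close to
    [c] that this integral is negative ([negative_test]).

    With [y = (x - c) / D], where [supp mu] lies in [[c - D, c + D]], the choice
    is [Q = (D_j(y) / K)^2], where [K = 2 j + 1] is about [n / 2] and [D_j] is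
    the Dirichlet kernel [sin (K t) / sin t] written as a polynomial of degree
    [2 j] in [y = sin t].  On [[-1, 1]] it satisfies [|y D_j(y)| <= 1] and
    [D_j(y) >= K (1 - (K y)^2 / 6)], so, with [s = D / K] and densities between
    [m] and [M] near [E]:
    - for [|x - c| <= s / 2] the integrand is at most
      [- (h^2 - s^2 / 4) (23 / 24)^4], which contributes at most [- m s] times
      [(h^2 - s^2 / 4) (23 / 24)^4];
    - for [|x - c| >= h] the integrand is at most [s^4 / (x - c)^2], which
      contributes at most [2 M s^4 / h] near [E], and [O(s^4)] far from it;
    - in between the integrand is nonpositive.
    For [h] of the order of [s], the first contribution and the one near [E] have
    order [s^3], and the negative one wins once [h >= (9 / 5) r s], where
    [r >= 1] and [M <= (11 / 10) r m]
    ([Rintegral_test_poly_le], [test_value_lt0]).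

    For [C > 4 pi d(E) rho], [rho] being the limit of the oscillation ratio,
    [h = C / (2 n)] exceeds [2 pi d(E) rho / n], whereas [s] is about
    [2 d(E) / n]; since [pi >= 2] this makes [h] at least [2 rho s] up to small
    errors, which leaves room for the approximations made in [D], [K] and
    [M / m] ([window_scales]). *)

(** * Gauss quadrature for a positive functional *)

Lemma rootless_constant_sign (R : realType) (g : {poly R}) : (forall x, ~~ root g x) ->
  (forall x, 0 <= g.[x]) \/ (forall x, 0 <= (- g).[x]).
Proof.
move=> g_noroot.
have g_neq0 x : g.[x] != 0 by have := g_noroot x; rewrite /root.
have no_change (f : {poly R}) x y : (forall z, ~~ root f z) -> x <= y ->
    ~ (f.[x] <= 0 <= f.[y]).
  by move=> f_noroot xy /(poly_ivt xy)[z _]; exact/negP.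
have opp_noroot z : ~~ root (- g) z by rewrite rootN.
have [g0|g0] := leP 0 g.[0]; [left|right] => x; rewrite ?hornerN ?oppr_ge0.
- rewrite leNgt; apply/negP => gx; have [x0|x0] := leP x 0.
    by apply: (no_change g _ _ g_noroot x0); rewrite g0 ltW.
  apply: (no_change (- g) _ _ opp_noroot (ltW x0)).
  by rewrite !hornerN oppr_le0 oppr_ge0 g0 ltW.
- rewrite leNgt; apply/negP => gx; have [x0|x0] := leP x 0.
    apply: (no_change (- g) _ _ opp_noroot x0).
    by rewrite !hornerN oppr_le0 oppr_ge0 !ltW.
  by apply: (no_change g _ _ g_noroot (ltW x0)); rewrite !ltW.
Qed.

Section Quadrature.
Variables (R : realType) (L : {poly R} -> R).
Hypothesis L_linear : forall c (f g : {poly R}), L (c *: f + g) = c * L f + L g.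
Hypothesis L_gt0 : forall f : {poly R}, f != 0 -> (forall x, 0 <= f.[x]) -> 0 < L f.

Lemma functional0 : L 0 = 0.
Proof.
have := L_linear 1 0 0; rewrite scaler0 addr0 mul1r => /eqP.
by rewrite -subr_eq0 opprD addNKr oppr_eq0 => /eqP.
Qed.

Lemma functionalZ c f : L (c *: f) = c * L f.
Proof. by have := L_linear c f 0; rewrite !addr0 functional0 addr0. Qed.

Lemma functionalB f g : L (f - g) = L f - L g.
Proof. by rewrite addrC -scaleN1r L_linear mulN1r addrC. Qed.

Lemma functional_sum_sq_ge0 (I : eqType) (s : seq I) (c : I -> R) (g : I -> {poly R}) :
  (forall i, i \in s -> 0 <= c i) ->
  0 <= L (\sum_(i <- s) c i *: g i ^+ 2).
Proof.
elim: s => [|i s IH] c_ge0; first by rewrite big_nil functional0.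
rewrite big_cons L_linear addr_ge0 //.
- rewrite mulr_ge0 ?c_ge0 ?mem_head //.
  have [->|g_neq0] := eqVneq (g i) 0; first by rewrite expr0n functional0.
  by rewrite ltW // L_gt0 ?expf_neq0 // => x; rewrite horner_exp sqr_ge0.
- by apply: IH => k ks; rewrite c_ge0 // in_cons ks orbT.
Qed.

Variables (n : nat) (p : {poly R}).
Hypothesis size_p : size p = n.+1.
Hypothesis L_orth : forall g : {poly R}, (size g <= n)%N -> L (p * g) = 0.

Let p_neq0 : p != 0. Proof. by rewrite -size_poly_eq0 size_p. Qed.

(** Let [q] be the product of the [X - r] over the distinct real roots [r], and
    [p = q g].  If [g] has a root [r], then [(X - r)^2] divides [p] and the
    cofactor [t], of degree [n - 2], gives [L (p t) = L ((X - r)^2 t^2) > 0];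
    if [g] has none, it has constant sign and [L (p q) = L (g q^2)] is nonzero.
    Both contradict orthogonality unless [q] has degree [n]. *)
Lemma orthogonal_poly_roots :
  exists rs : seq R, [/\ uniq rs, all (root p) rs & size rs = n].
Proof.
pose P (k : nat) := `[< exists rs : seq R, [/\ uniq rs, all (root p) rs & size rs = k] >].
have exP : exists k, P k by exists 0; apply/asboolP; exists [::].
have P_le k : P k -> (k <= n)%N.
  move=> /asboolP[rs [rs_uniq rs_root <-]].
  by rewrite -ltnS -size_p max_poly_roots.
have [k /asboolP[rs [rs_uniq rs_root size_rs]] k_max] := ex_maxnP exP P_le.
have [n_le_k|k_lt_n] := leqP n k.
  exists rs; split=> //; apply/eqP; rewrite size_rs eqn_leq n_le_k andbT.
  by apply: P_le; apply/asboolP; exists rs.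
have rs_roots : uniq_roots rs by rewrite uniq_rootsE.
have [g p_eq] := uniq_roots_prod_XsubC rs_root rs_roots.
set q := \prod_(z <- rs) _ in p_eq.
have q_neq0 : q != 0 by apply: contra_neq p_neq0 => q0; rewrite p_eq q0 mulr0.
have g_neq0 : g != 0 by apply: contra_neq p_neq0 => g0; rewrite p_eq g0 mul0r.
have Lpq : L (p * q) = 0 by apply: L_orth; rewrite size_prod_XsubC size_rs.
have Lq2_gt0 (e : {poly R}) : e != 0 -> (forall x, 0 <= e.[x]) ->
    0 < L (e * q ^+ 2).
  move=> e_neq0 e_ge0; apply: L_gt0; first by rewrite mulf_neq0 ?expf_neq0.
  by move=> x; rewrite hornerM horner_exp mulr_ge0 ?sqr_ge0.
have gqq : g * q ^+ 2 = p * q by rewrite p_eq expr2 mulrA.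
have [[r g_r]|g_noroot] := pselect (exists r, root g r); last first.
  have {}g_noroot x : ~~ root g x by apply/negP => gx; apply: g_noroot; exists x.
  have [g_ge0|g_le0] := rootless_constant_sign g_noroot.
  - by have := Lq2_gt0 _ g_neq0 g_ge0; rewrite gqq Lpq ltxx.
  - have := Lq2_gt0 (- g); rewrite oppr_eq0 => /(_ g_neq0 g_le0).
    by rewrite mulNr gqq -scaleN1r functionalZ Lpq mulr0 ltxx.
have p_r : root p r by rewrite p_eq rootM g_r.
have r_rs : r \in rs.
  apply/negPn/negP => r_notin; have := k_max k.+1; rewrite ltnn => /(_ _)/negP.
  apply=> //; apply/asboolP; exists (r :: rs).
  by rewrite /= r_notin rs_uniq p_r rs_root size_rs.
have q_r : root q r by rewrite root_prod_XsubC.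
have /factor_theorem[g' g_eq] := g_r; have /factor_theorem[q' q_eq] := q_r.
pose t := g' * q'.
have p_t : p = ('X - r%:P) ^+ 2 * t by rewrite p_eq g_eq q_eq /t; ring.
have t_neq0 : t != 0 by apply: contra_neq p_neq0 => t0; rewrite p_t t0 mulr0.
have size_t : (size t <= n)%N.
  have := size_p; rewrite p_t size_mul ?expf_neq0 ?polyXsubC_eq0 //.
  by rewrite size_exp_XsubC /= => -[<-]; exact: leq_addl.
have : 0 < L (p * t).
  rewrite p_t -mulrA -expr2; apply: L_gt0.
    by rewrite mulf_neq0 ?expf_neq0 ?polyXsubC_eq0.
  by move=> x; rewrite hornerM !horner_exp mulr_ge0 ?sqr_ge0.
by rewrite L_orth // ltxx.
Qed.

(** The sum [s] below interpolates [f] at the zeros of [p] by squares [l y ^+ 2]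
    of unnormalized Lagrange polynomials, with nonnegative weights.  As [f - s]
    vanishes at the zeros of [p], it is a multiple of [p] by a polynomial of
    degree less than [n], so that [L f = L s]. *)
Lemma quadrature_ge0 (f : {poly R}) : (size f <= n.*2)%N ->
  (forall x, root p x -> 0 <= f.[x]) -> 0 <= L f.
Proof.
move=> size_f f_ge0.
have [rs [rs_uniq rs_root size_rs]] := orthogonal_poly_roots.
pose l y := \prod_(z <- rem y rs) ('X - z%:P).
have l_neq0 y : y \in rs -> (l y).[y] != 0.
  move=> y_rs; rewrite -[_ == 0]/(root _ _) root_prod_XsubC.
  by rewrite mem_rem_uniq // !inE eqxx.
have l_eq0 x y : x \in rs -> x != y -> (l y).[x] = 0.
  move=> x_rs xy; apply/rootP; rewrite root_prod_XsubC.
  by rewrite mem_rem_uniq // !inE xy.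
pose s := \sum_(y <- rs) (f.[y] / (l y).[y] ^+ 2) *: l y ^+ 2.
have s_at x : x \in rs -> s.[x] = f.[x].
  move=> x_rs; rewrite /s horner_sum (big_rem x) //= big_seq big1 ?addr0.
    by rewrite hornerZ horner_exp divfK // expf_neq0 // l_neq0.
  move=> y; rewrite mem_rem_uniq // !inE => /andP[yx y_rs].
  have xy : x != y by rewrite eq_sym.
  by rewrite hornerZ horner_exp (l_eq0 x y) // expr0n mulr0.
have size_s : (size s <= n.*2)%N.
  rewrite /s big_seq; apply: (big_ind (fun g : {poly R} => size g <= n.*2)%N).
  - by rewrite size_poly0.
  - by move=> g h sg sh; rewrite (leq_trans (size_polyD _ _)) // geq_max sg.
  - move=> y y_rs; apply: leq_trans (size_scale_leq _ _) _.
    apply: leq_trans (size_poly_exp_leq _ _) _.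
    rewrite size_prod_XsubC size_rem // size_rs /=.
    have n_gt0 : (0 < n)%N by rewrite -size_rs; case: (rs) y_rs.
    by rewrite -muln2 ltn_mul2r /= ltn_predL.
have /uniq_roots_prod_XsubC : all (root (f - s)) rs.
  by apply/allP => x x_rs; rewrite /root hornerD hornerN s_at // subrr.
rewrite uniq_rootsE => /(_ rs_uniq) [g fs_eq].
have [c c_neq0 p_eq] : exists2 c, c != 0 & p = c *: \prod_(z <- rs) ('X - z%:P).
  exists (lead_coef p); first by rewrite lead_coef_eq0.
  by rewrite -all_roots_prod_XsubC ?uniq_rootsE // size_p size_rs.
have {}fs_eq : f - s = p * (c^-1 *: g).
  by rewrite p_eq -scalerAr -scalerAl scalerA mulVf // scale1r mulrC.
have size_g : (size (c^-1 *: g) <= n)%N.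
  have [->|g_neq0] := eqVneq (c^-1 *: g) 0; first by rewrite size_poly0.
  have : (size (p * (c^-1 *: g))%R <= n.*2)%N.
    by rewrite -fs_eq (leq_trans (size_polyD _ _)) // size_polyN geq_max size_f.
  by rewrite size_mul // size_p addSn /= -addnn leq_add2l.
have /eqP := L_orth size_g; rewrite -fs_eq functionalB subr_eq0 => /eqP ->.
apply: functional_sum_sq_ge0 => y y_rs; rewrite divr_ge0 ?sqr_ge0 ?f_ge0 //.
exact: (allP rs_root).
Qed.
End Quadrature.

(** * The Dirichlet kernel as a polynomial in the sine *)

Section DirichletKernel.
Variable R : realType.
Implicit Types (i j : nat) (y t : R).

(** The Chebyshev polynomial of index [i] at [1 - 2 X^2]: it expresses
    [cos (2 i t)] through [sin t]. *)
Fixpoint cos_double_poly i : {poly R} :=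
  if i is k.+1 then
    if k is l.+1 then
      (2 *: (1 - 2 *: 'X^2)) * cos_double_poly k - cos_double_poly l
    else 1 - 2 *: 'X^2
  else 1.

Lemma nat_pair_ind (P : nat -> Prop) :
  P 0 -> P 1 -> (forall i, P i -> P i.+1 -> P i.+2) -> forall i, P i.
Proof.
move=> P0 P1 PS i; suff [] : P i /\ P i.+1 by [].
by elim: i => [|i [Pi PSi]]; split=> //; exact: PS.
Qed.

Lemma horner_cos_double_poly i t :
  (cos_double_poly i).[sin t] = cos (i%:R * (2 * t)).
Proof.
have cos2t : cos (2 * t) = 1 - 2 * sin t ^+ 2.
  by rewrite mulr_natl mulr2n cosD -!expr2 cos2sin2; ring.
elim/nat_pair_ind: i => [||i IH0 IH1].
- by rewrite hornerC mul0r cos0.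
- by rewrite mul1r cos2t /= !hornerE.
rewrite [LHS]/= -/(cos_double_poly i.+1) hornerD hornerN hornerM IH0 IH1.
have -> : (2 *: (1 - 2 *: 'X^2) : {poly R}).[sin t] = 2 * cos (2 * t).
  by rewrite cos2t !hornerE.
rewrite -[i.+2]addn2 -[i.+1]addn1 !natrD.
set a := i%:R * (2 * t).
have -> : (i%:R + 1) * (2 * t) = a + 2 * t by rewrite /a; ring.
have -> : (i%:R + 2) * (2 * t) = (a + 2 * t) + 2 * t by rewrite /a; ring.
have aE : cos a = cos ((a + 2 * t) - 2 * t) by rewrite addrK.
by rewrite aE [cos (_ - _)]cosB [in RHS]cosD; ring.
Qed.

Lemma size_cos_double_poly i : (size (cos_double_poly i) <= i.*2.+1)%N.
Proof.
have size_2 : (size (1 - 2 *: 'X^2 : {poly R})%R <= 3)%N.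
  rewrite (leq_trans (size_polyD _ _)) // size_poly1 size_polyN.
  by rewrite geq_max /= (leq_trans (size_scale_leq _ _)) // size_polyXn.
elim/nat_pair_ind: i => [||i IH0 IH1] //; first by rewrite size_poly1.
rewrite [cos_double_poly i.+2]/= -/(cos_double_poly i.+1).
rewrite (leq_trans (size_polyD _ _)) // size_polyN geq_max.
rewrite (leq_trans IH0) ?andbT; last by rewrite doubleS; lia.
rewrite (leq_trans (size_polyMleq _ _)) //.
rewrite -[i.+2.*2.+1]/((3 + i.+1.*2.+1).-1) -!subn1 leq_sub2r // leq_add //.
exact: leq_trans (size_scale_leq _ _) size_2.
Qed.

Lemma sin_nat_mul_le i t : `|sin (i%:R * t)| <= i%:R * `|sin t|.
Proof.
elim: i => [|i IH]; first by rewrite !mul0r sin0 normr0.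
rewrite -addn1 natrD !mulrDl !mul1r sinD (le_trans (ler_normD _ _)) //.
rewrite !normrM lerD //.
- rewrite -[leRHS]mulr1 ler_pM // ?IH // ler_norml cos_geN1 cos_le1 //.
- by rewrite -[leRHS]mul1r ler_wpM2r // ler_norml cos_geN1 cos_le1.
Qed.

Lemma sin_onto y : -1 <= y <= 1 -> exists t, y = sin t.
Proof. by move=> y1; exists (asin y); rewrite asinK // in_itv. Qed.

(** [1 - cos (2 i t) = 2 sin (i t) ^ 2 <= 2 i^2 sin t ^ 2]. *)
Lemma cos_double_poly_ge i y : -1 <= y <= 1 ->
  1 - 2 * i%:R ^+ 2 * y ^+ 2 <= (cos_double_poly i).[y].
Proof.
move=> /sin_onto[t ->]; rewrite horner_cos_double_poly.
have -> : i%:R * (2 * t) = i%:R * t + i%:R * t by ring.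
rewrite cosD -!expr2 cos2sin2.
have := sin_nat_mul_le i t.
rewrite -(@ler_pXn2r _ 2) ?nnegrE ?mulr_ge0 // exprMn !real_normK ?num_real //.
lra.
Qed.

(** [D_j (t) = 1 + 2 cos (2 t) + ... + 2 cos (2 j t)] in terms of [sin t]. *)
Definition dirichlet_poly j : {poly R} :=
  1 + \sum_(i < j) 2 *: cos_double_poly i.+1.

Lemma dirichlet_polyS j :
  dirichlet_poly j.+1 = dirichlet_poly j + 2 *: cos_double_poly j.+1.
Proof. by rewrite /dirichlet_poly big_ord_recr /= addrA. Qed.

Lemma size_dirichlet_poly j : (size (dirichlet_poly j) <= j.*2.+1)%N.
Proof.
elim: j => [|j IH]; first by rewrite /dirichlet_poly big_ord0 addr0 size_poly1.
rewrite dirichlet_polyS (leq_trans (size_polyD _ _)) // geq_max.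
rewrite (leq_trans IH) ?(leq_trans (size_scale_leq _ _)) //.
  exact: size_cos_double_poly.
by rewrite doubleS; lia.
Qed.

(** The sum telescopes, because
    [2 sin t cos (2 i t) = sin ((2 i + 1) t) - sin ((2 i - 1) t)]. *)
Lemma mul_dirichlet_poly j t :
  sin t * (dirichlet_poly j).[sin t] = sin (j.*2.+1%:R * t).
Proof.
elim: j => [|j IH].
  by rewrite /dirichlet_poly big_ord0 addr0 hornerC mulr1 mul1r.
rewrite dirichlet_polyS hornerD mulrDr IH hornerZ horner_cos_double_poly.
set a := j.+1%:R * (2 * t).
have -> : j.+1.*2.+1%:R * t = a + t.
  by rewrite /a -muln2 -addn1 natrD natrM; ring.
have -> : j.*2.+1%:R * t = a - t.
  by rewrite /a -[j.+1]addn1 -muln2 -addn1 !natrD natrM; ring.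
by rewrite (sinD a t) (sinB a t); ring.
Qed.

Lemma mul_dirichlet_poly_le1 j y : -1 <= y <= 1 ->
  `|y * (dirichlet_poly j).[y]| <= 1.
Proof.
move=> /sin_onto[t ->]; rewrite mul_dirichlet_poly ler_norml.
by rewrite sin_geN1 sin_le1.
Qed.

(** Sum the lower bounds [1 - 2 i^2 y^2] of the cosines.  The induction needs
    the exact value of the sum of squares, [j (j + 1) (2 j + 1) / 6], which is
    [K (K^2 - 1) / 24]. *)
Lemma dirichlet_poly_ge j y : -1 <= y <= 1 ->
  j.*2.+1%:R * (1 - (j.*2.+1%:R * y) ^+ 2 / 6) <= (dirichlet_poly j).[y].
Proof.
move=> y1; pose K : R := j.*2.+1%:R.
suff : K * (1 - (K ^+ 2 - 1) * y ^+ 2 / 6) <= (dirichlet_poly j).[y].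
  apply: le_trans; rewrite ler_wpM2l ?ler0n // exprMn.
  by rewrite -/K -subr_ge0 (_ : _ - _ = y ^+ 2 / 6) ?divr_ge0 ?sqr_ge0 //; field.
rewrite {}/K; elim: j => [|j IH].
  by rewrite /dirichlet_poly big_ord0 addr0 hornerC /= mul1r expr1n subrr !mul0r subr0.
rewrite dirichlet_polyS hornerD hornerZ.
have := cos_double_poly_ge j.+1 y1; move: IH.
have -> : j.+1.*2.+1%:R = 2 * j%:R + 3 :> R.
  by rewrite -muln2 -addn1 natrD natrM -[j.+1]addn1 natrD; ring.
have -> : j.*2.+1%:R = 2 * j%:R + 1 :> R.
  by rewrite -muln2 -addn1 natrD natrM; ring.
have -> : j.+1%:R = j%:R + 1 :> R by rewrite -addn1 natrD.
nra.
Qed.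
End DirichletKernel.

(** * The inverse square against a measure with bounded density *)

Section InverseSquare.
Variables (R : realType) (c h : R).
Hypothesis h_gt0 : 0 < h.

(** Truncating at distance [h] from [c] makes [(x - c)^-2] continuous, hence
    measurable and bounded, on the whole line. *)
Definition inv_sq (x : R) := (Num.max `|x - c| h) ^- 2.

Lemma inv_sq_gt0 x : 0 < inv_sq x.
Proof. by rewrite /inv_sq invr_gt0 exprn_gt0 // lt_max h_gt0 orbT. Qed.

Lemma inv_sq_le x : inv_sq x <= h ^- 2.
Proof.
rewrite /inv_sq lef_pV2 ?posrE ?exprn_gt0 ?lt_max ?h_gt0 ?orbT //.
by rewrite lerXn2r ?nnegrE ?le_max ?lexx ?normr_ge0 ?orbT // ltW.
Qed.

Lemma inv_sq_out x : h <= `|x - c| -> inv_sq x = (x - c) ^- 2.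
Proof.
by move=> hx; rewrite /inv_sq (max_idPl hx) real_normK ?num_real.
Qed.

Lemma continuous_inv_sq : continuous inv_sq.
Proof.
move=> x; rewrite /inv_sq; apply: cvgV.
  by rewrite expf_neq0 // gt_eqF // lt_max h_gt0 orbT.
have maxE : Num.max `|y - c| h @[y --> x] --> Num.max `|x - c| h; last first.
  have := @exprn_continuous R 2 (Num.max `|x - c| h).
  by move/(cvg_comp _ _ maxE); exact.
have := @continuous_max _ _ (fun y => `|y - c| : R^o) (cst h) x; apply; last exact: cvg_cst.
by apply: cvg_norm; apply: cvgB; [exact: cvg_id|exact: cvg_cst].
Qed.

Lemma measurable_inv_sq (A : set R) : measurable_fun A inv_sq.
Proof.
by apply: measurable_funTS; apply: continuous_measurable_fun; exact: continuous_inv_sq.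
Qed.

Lemma integral_inv_sq p q : p < q ->
  {in `[p, q], forall x, h <= `|x - c|} ->
  (\int[@lebesgue_measure R]_(x in `[p, q]) (inv_sq x)%:E =
   ((p - c)^-1 - (q - c)^-1)%:E)%E.
Proof.
move=> pq out; pose F x := - (x - c)^-1.
have neq0 x : x \in `[p, q] -> x - c != 0.
  by move=> /out hx; rewrite -normr_gt0 (lt_le_trans h_gt0).
have F_cont x : x \in `[p, q] -> F y @[y --> x] --> F x.
  move=> xpq; apply: cvgN; apply: cvgV; first exact: neq0.
  by apply: cvgB; [exact: cvg_id|exact: cvg_cst].
have F_derive x : x \in `]p, q[ -> is_derive x 1 F (inv_sq x).
  move=> xpq; have xpq' : x \in `[p, q] := subset_itv_oo_cc xpq.
  have dx : is_derive x (1 : R) (fun y => y - c) 1.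
    by apply: is_derive_eq; rewrite subr0.
  have := is_deriveN (@is_deriveV _ (fun y => y - c) x 1 1 (neq0 x xpq') dx).
  by move/is_derive_eq; apply; rewrite scaleNr opprK inv_sq_out ?out // /GRing.scale /= mulr1.
have -> : (p - c)^-1 - (q - c)^-1 = F q - F p by rewrite /F opprK addrC.
rewrite EFinB; apply: continuous_FTC2 => //.
- exact/continuous_subspaceT/continuous_inv_sq.
- split.
  + by move=> x xpq; have [] := F_derive x xpq.
  + by apply: cvg_at_right_filter; apply: F_cont; rewrite in_itv /= lexx ltW.
  + by apply: cvg_at_left_filter; apply: F_cont; rewrite in_itv /= lexx ltW.
- by move=> x xpq; rewrite derive1E; have [_ ->] := F_derive x xpq.
Qed.
End InverseSquare.

(** A domination [mu <= M lambda] inside [N] becomes a domination of measures on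
    the whole line once the part of [mu] outside [N] is added to [M lambda];
    that part does not contribute to integrals over [N]. *)
Lemma ge0_integral_le_lebesgue (R : realType)
    (mu : {measure set (measurableTypeR R) -> \bar R}) (N : set R) (M : R)
    (f : R -> R) :
  measurable N -> 0 <= M ->
  (forall A, measurable A -> A `<=` N ->
     (mu A <= M%:E * @lebesgue_measure R A)%E) ->
  (forall x, 0 <= f x) -> measurable_fun setT f ->
  (\int[mu]_(x in N) (f x)%:E <=
   M%:E * \int[@lebesgue_measure R]_(x in N) (f x)%:E)%E.
Proof.
move=> mN M_ge0 muM f_ge0 mf.
have mNC : measurable (~` N) by exact: measurableC.
have mfE (A : set R) : measurable_fun A (EFin \o f).
  exact/measurable_funTS/measurable_EFinP.
pose nuM : {measure set (measurableTypeR R) -> \bar R} :=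
  mscale (NngNum M_ge0) (@lebesgue_measure R).
pose muC : {measure set (measurableTypeR R) -> \bar R} := mrestr mu mNC.
apply: (@le_trans _ _ (\int[measure_add nuM muC]_(x in N) (f x)%:E)%E).
  apply: ge0_le_measure_integral => //; last exact: mfE.
    move=> S mS; rewrite -[X in (mu X <= _)%E](setUIDK S N).
    have -> : mu ((S `&` N) `|` (S `\` N)) = (mu (S `&` N) + mu (S `\` N))%E.
      rewrite measureU //; [exact: measurableI|exact: measurableD|].
      by rewrite setDE setIACA setICr setI0.
    rewrite [leRHS](measure_addE nuM muC S).
    rewrite leeD2r //.
    apply: (le_trans (muM _ (measurableI _ _ mS mN) (@subIsetr _ _ _))).
    by apply: lee_wpmul2l => //; apply: le_measure; rewrite ?inE //; exact: measurableI.
have f_geE x : N x -> (0 <= (f x)%:E)%E by rewrite lee_fin.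
rewrite ge0_integral_measure_add //; last exact: mfE.
rewrite (@null_set_integral _ _ _ muC N) ?adde0 //.
- by rewrite ge0_integral_mscale //; exact: mfE.
- exact: mfE.
- by rewrite /muC /= /mrestr setICr measure0.
Qed.

Section MeasureOnInterval.
Variables (R : realType) (mu : probability (measurableTypeR R) R) (lo hi : R).
Hypothesis mu_out : mu (~` `[lo, hi]%classic) = 0%E.
Let S := `[lo, hi]%classic.

Lemma integrable_poly (q : {poly R}) : mu.-integrable setT (EFin \o horner q).
Proof.
have mq (A : set R) : measurable_fun A (EFin \o horner q).
  by apply/measurable_EFinP; exact: measurable_poly.
have mS : measurable S by exact: measurable_itv.
rewrite (@negligible_integrable _ _ _ mu setT (~` S)) //; last 2 first.
- exact: measurableC.
- exact: mq.
rewrite setTD setCK; apply: measurable_bounded_integrable => //.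
- by rewrite (le_lt_trans (probability_le1 _ _)) // ltry.
- exact: measurable_poly.
- have : compact (horner q @` S).
    apply: continuous_compact; last exact: segment_compact.
    exact/continuous_subspaceT/continuous_horner.
  move=> /compact_bounded[B [Breal bnd]]; exists B; split => // x Bx y Sy.
  by apply: (bnd x Bx); exists y.
Qed.

Lemma Rintegral_poly_itv (q : {poly R}) :
  \int[mu]_x q.[x] = \int[mu]_(x in S) q.[x].
Proof.
have mS : measurable S by exact: measurable_itv.
rewrite /Rintegral (@negligible_integral _ _ _ mu setT (~` S)) //.
- by rewrite setTD setCK.
- exact: measurableC.
- exact: integrable_poly.
Qed.
End MeasureOnInterval.

Section Annulus.
Variables (R : realType) (mu : probability (measurableTypeR R) R).
Variables (c h d M : R).
Hypotheses (h_gt0 : 0 < h) (h_lt : h < d) (M_ge0 : 0 <= M).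
Hypothesis mu_le : forall A : set R, measurable A ->
  A `<=` `[c - d, c + d]%classic -> (mu A <= M%:E * @lebesgue_measure R A)%E.

Lemma Rintegral_inv_sq_le p q : p < q -> c - d <= p -> q <= c + d ->
  {in `[p, q], forall x, h <= `|x - c|} ->
  (p - c)^-1 - (q - c)^-1 <= h^-1 ->
  \int[mu]_(x in `[p, q]) inv_sq c h x <= M / h.
Proof.
move=> pq dp qd out le_h; rewrite /Rintegral -lee_fin.
have ge0 : (0 <= \int[mu]_(x in `[p, q]) (inv_sq c h x)%:E)%E.
  by apply: integral_ge0 => x _; rewrite lee_fin ltW // inv_sq_gt0.
have le_Mh : (\int[mu]_(x in `[p, q]) (inv_sq c h x)%:E <= (M / h)%:E)%E.
  apply: (@le_trans _ _
    (M%:E * \int[@lebesgue_measure R]_(x in `[p, q]) (inv_sq c h x)%:E)%E).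
    apply: ge0_integral_le_lebesgue => //; last 2 first.
    - by move=> x; rewrite ltW // inv_sq_gt0.
    - exact: measurable_inv_sq.
    move=> A mA A_sub; apply: mu_le => // x /A_sub /=; rewrite !in_itv /=.
    by move=> /andP[px xq]; rewrite (le_trans dp) // (le_trans xq).
  by rewrite integral_inv_sq // -EFinM lee_fin ler_wpM2l.
rewrite fineK // ge0_fin_numE //.
by rewrite (le_lt_trans le_Mh) // ltry.
Qed.

Lemma Rintegral_inv_sq_right :
  \int[mu]_(x in `[c + h, c + d]) inv_sq c h x <= M / h.
Proof.
have [hp hd] := (h_gt0, h_lt).
apply: Rintegral_inv_sq_le => //; [by lra|by lra| |].
- move=> x; rewrite in_itv /= => /andP[hx _].
  by rewrite (le_trans _ (ler_norm _)) //; lra.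
- have -> : c + h - c = h by ring.
  have -> : c + d - c = d by ring.
  by rewrite gerBl invr_ge0; lra.
Qed.

Lemma Rintegral_inv_sq_left :
  \int[mu]_(x in `[c - d, c - h]) inv_sq c h x <= M / h.
Proof.
have [hp hd] := (h_gt0, h_lt).
apply: Rintegral_inv_sq_le => //; [by lra|by lra| |].
- move=> x; rewrite in_itv /= => /andP[_ hx].
  by rewrite -normrN (le_trans _ (ler_norm _)) //; lra.
- have -> : c - d - c = - d by ring.
  have -> : c - h - c = - h by ring.
  by rewrite !invrN opprK addrC gerBl invr_ge0; lra.
Qed.
End Annulus.
(** * A polynomial concentrated at scale [D / K] *)

Section TestPolynomial.
Variables (R : realType) (c h D : R) (j : nat).
Local Notation K := (j.*2.+1%:R : R).

(** The fourth power of the kernel decays like [(x - c)^-4], which is what makes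
    the product with the quadratic factor integrable at scale [D / K]; the
    second power would not suffice. *)
Definition test_poly : {poly R} :=
  (('X - c%:P) ^+ 2 - (h ^+ 2)%:P) *
  (K^-1 *: (dirichlet_poly R j \Po (D^-1 *: ('X - c%:P)))) ^+ 4.

Definition profile (x : R) : R := (dirichlet_poly R j).[(x - c) / D] / K.

Lemma horner_test_poly x :
  test_poly.[x] = ((x - c) ^+ 2 - h ^+ 2) * profile x ^+ 4.
Proof.
rewrite /test_poly /profile hornerM hornerD hornerN !horner_exp hornerZ.
rewrite horner_comp hornerZ hornerXsubC hornerC.
by rewrite [D^-1 * _]mulrC [K^-1 * _]mulrC.
Qed.

Lemma size_test_poly : (size test_poly <= 8 * j + 3)%N.
Proof.
rewrite /test_poly (leq_trans (size_polyMleq _ _)) //.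
have size_quad : (size (('X - c%:P) ^+ 2 - (h ^+ 2)%:P)%R <= 3)%N.
  rewrite (leq_trans (size_polyD _ _)) // size_polyN geq_max size_exp_XsubC /=.
  by rewrite (leq_trans (size_polyC_leq1 _)).
have size_comp : (size (K^-1 *: (dirichlet_poly R j \Po (D^-1 *: ('X - c%:P))))%R
    <= j.*2.+1)%N.
  rewrite (leq_trans (size_scale_leq _ _)) //.
  rewrite (leq_trans (size_comp_poly_leq _ _)) // ltnS -[leqRHS]muln1.
  rewrite leq_mul //; last first.
    by rewrite -subn1 leq_subLR (leq_trans (size_scale_leq _ _)) // size_XsubC.
  by rewrite -subn1 leq_subLR add1n size_dirichlet_poly.
have size_four : (size ((K^-1 *: (dirichlet_poly R j \Po (D^-1 *: ('X - c%:P))))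
    ^+ 4)%R <= (8 * j).+1)%N.
  rewrite (leq_trans (size_poly_exp_leq _ _)) // ltnS.
  rewrite (@leq_trans (j.*2 * 4)%N) ?leq_mul2r //=; last by lia.
  by rewrite -subn1 leq_subLR add1n.
rewrite -subn1 leq_subLR (leq_trans (leq_add size_quad size_four)) //; lia.
Qed.

Hypothesis D_gt0 : 0 < D.

Let K_gt0 : 0 < K. Proof. by rewrite ltr0n. Qed.

Let scaled_itv x : `|x - c| <= D -> -1 <= (x - c) / D <= 1.
Proof.
move=> xD; rewrite -ler_norml normrM normfV (gtr0_norm D_gt0).
by rewrite ler_pdivrMr // mul1r.
Qed.

Lemma profile_decay x : `|x - c| <= D -> profile x ^+ 2 * (x - c) ^+ 2 <= (D / K) ^+ 2.
Proof.
move=> /scaled_itv /(mul_dirichlet_poly_le1 j) le1; rewrite /profile -exprMn.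
set d := (dirichlet_poly R j).[_] in le1 *.
have -> : d / K * (x - c) = (x - c) / D * d * (D / K).
  by field; rewrite !gt_eqF.
rewrite exprMn -[leRHS]mul1r ler_wpM2r ?sqr_ge0 //.
by rewrite -real_normK ?num_real // expr_le1.
Qed.

(** At distance [D / (2 K)] the bound [1 - (K y)^2 / 6] is [1 - 1 / 24]. *)
Lemma profile_ge x : `|x - c| <= D / (2 * K) -> 23 / 24 <= profile x.
Proof.
move=> x_near; have K_ge1 : 1 <= K by rewrite ler1n.
have xD : `|x - c| <= D.
  by rewrite (le_trans x_near) // ler_pdivrMr ?mulr_gt0 // ler_peMr ?(ltW D_gt0) //; lra.
have := dirichlet_poly_ge j (scaled_itv xD).
rewrite /profile ler_pdivlMr // => /(le_trans _); apply.
rewrite mulrC ler_wpM2l ?(ltW K_gt0) //.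
suff : (K * ((x - c) / D)) ^+ 2 <= (2^-1) ^+ 2 by lra.
rewrite -real_normK ?num_real // lerXn2r ?nnegrE ?invr_ge0 // !normrM normfV.
rewrite (gtr0_norm D_gt0) (gtr0_norm K_gt0) mulrA ler_pdivrMr // mulrC.
rewrite -ler_pdivlMr //; apply: le_trans x_near _.
by rewrite le_eqVlt; apply/orP; left; apply/eqP; field; rewrite gt_eqF.
Qed.

Hypothesis h_gt0 : 0 < h.

Lemma test_poly_le0 x : `|x - c| <= h -> test_poly.[x] <= 0.
Proof.
move=> xh; rewrite horner_test_poly mulr_le0_ge0 ?exprn_even_ge0 // subr_le0.
by rewrite -real_normK ?num_real // lerXn2r ?nnegrE // (ltW h_gt0).
Qed.

Lemma test_poly_far x : h <= `|x - c| -> `|x - c| <= D ->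
  test_poly.[x] <= (D / K) ^+ 4 * (x - c) ^- 2.
Proof.
move=> hx xD; have xc_gt0 : 0 < (x - c) ^+ 2.
  by rewrite exprn_even_gt0 //= -normr_gt0 (lt_le_trans h_gt0).
rewrite horner_test_poly ler_pdivlMr //.
apply: (@le_trans _ _ ((x - c) ^+ 2 * profile x ^+ 4 * (x - c) ^+ 2)).
  rewrite ler_wpM2r ?(ltW xc_gt0) // ler_wpM2r ?exprn_even_ge0 //.
  by rewrite gerBl sqr_ge0.
have -> : (x - c) ^+ 2 * profile x ^+ 4 * (x - c) ^+ 2 =
    (profile x ^+ 2 * (x - c) ^+ 2) ^+ 2 by ring.
have -> : (D / K) ^+ 4 = ((D / K) ^+ 2) ^+ 2 by rewrite -exprM.
have nneg_sq (u : R) : u ^+ 2 \is Num.nneg by rewrite nnegrE sqr_ge0.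
rewrite lerXn2r //; first by rewrite -exprMn.
exact: profile_decay.
Qed.

Lemma test_poly_core x : D / (2 * K) <= h -> `|x - c| <= D / (2 * K) ->
  test_poly.[x] <= - ((h ^+ 2 - (D / (2 * K)) ^+ 2) * (23 / 24) ^+ 4).
Proof.
move=> tau_h x_near; have tau_ge0 : 0 <= D / (2 * K).
  by rewrite divr_ge0 ?mulr_ge0 // ltW.
have sq_x : (x - c) ^+ 2 <= (D / (2 * K)) ^+ 2.
  by rewrite -real_normK ?num_real // lerXn2r ?nnegrE.
have sq_tau : (D / (2 * K)) ^+ 2 <= h ^+ 2 by rewrite lerXn2r ?nnegrE // ltW.
rewrite horner_test_poly -opprB mulNr lerN2 ler_pM ?subr_ge0 ?exprn_ge0 //.
- by rewrite lerB.
- by rewrite lerXn2r ?nnegrE ?profile_ge // (le_trans _ (profile_ge x_near)).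
Qed.
End TestPolynomial.
(** * Integrating the test polynomial *)

Section IntegralOfTest.
Variables (R : realType) (mu : probability (measurableTypeR R) R).
Variables (c h D d m M tau : R) (j : nat).
Local Notation K := (j.*2.+1%:R : R).
Hypothesis tauE : tau = D / (2 * K).
Hypotheses (tau_gt0 : 0 < tau) (tau_h : tau <= h) (h_d : h < d) (d_D : d <= D).
Hypotheses (M_ge0 : 0 <= M).
Hypothesis mu_out : mu (~` `[c - D, c + D]%classic) = 0%E.
Hypothesis mu_le : forall A : set R, measurable A ->
  A `<=` `[c - d, c + d]%classic -> (mu A <= M%:E * @lebesgue_measure R A)%E.
Hypothesis mu_ge : ((m * (2 * tau))%:E <= mu `[(c - tau)%R, (c + tau)%R]%classic)%E.

Let S := `[c - D, c + D]%classic.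
Let J := `[c - tau, c + tau]%classic.
Let N1 := `[c - d, c - h]%classic.
Let N2 := `[c + h, c + d]%classic.
Let B := (D / K) ^+ 4.
Let beta := (h ^+ 2 - tau ^+ 2) * (23 / 24) ^+ 4.
Let h_gt0 : 0 < h. Proof. exact: lt_le_trans tau_h. Qed.
Let d_gt0 : 0 < d. Proof. exact: lt_trans h_d. Qed.
Let D_gt0 : 0 < D. Proof. exact: lt_le_trans d_D. Qed.
Let B_ge0 : 0 <= B. Proof. exact: exprn_even_ge0. Qed.

(* The integrand, raised by [beta] on the core [J], is below a constant that
   accounts for the points far from [c], plus an inverse square on each side. *)
Let test_poly_le_step (x : R) : S x ->
  (test_poly c h D j).[x] + ((fun=> beta) \_ J) x <=
  B * d ^- 2 + (B * (inv_sq c h \_ N1) x + B * (inv_sq c h \_ N2) x).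
Proof.
have [[hp hd] [hD ht]] := ((h_gt0, h_d), (d_D, tau_h)).
have restr_ge0 (A : set R) : 0 <= B * (inv_sq c h \_ A) x.
  by rewrite mulr_ge0 // patchE; case: ifP => // _; rewrite ltW // inv_sq_gt0.
have far_ge0 : 0 <= B * d ^- 2 by rewrite mulr_ge0 // invr_ge0 exprn_ge0 // ltW.
rewrite /S /= in_itv /= => /andP[x1 x2].
have xD : `|x - c| <= D by rewrite ler_norml; apply/andP; split; lra.
have xJ : (x \in J) = (`|x - c| <= tau).
  rewrite ler_norml; apply/idP/idP; rewrite inE /J /= in_itv /=;
  by move=> /andP[? ?]; apply/andP; split; lra.
rewrite [X in _ + X <= _]patchE xJ; case: ifP => [x_near|_].
  by have := @test_poly_core _ c h D j D_gt0 h_gt0 x;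
     rewrite -tauE -/beta => /(_ tau_h x_near); have := restr_ge0 N1; have := restr_ge0 N2; lra.
rewrite addr0; have [x_h|/ltW h_x] := leP `|x - c| h.
  by rewrite (le_trans (test_poly_le0 _ _ _ _)) // addr_ge0 // addr_ge0.
apply: (le_trans (test_poly_far j D_gt0 h_gt0 h_x xD)); rewrite -/B.
have [x_d|d_x] := leP `|x - c| d; last first.
  apply: (@le_trans _ _ (B * d ^- 2)); last by rewrite lerDl addr_ge0.
  have sq_le : d ^+ 2 <= (x - c) ^+ 2.
    by rewrite -[leRHS]real_normK ?num_real // lerXn2r ?nnegrE // ltW.
  have sq_gt0 : 0 < d ^+ 2 by rewrite exprn_gt0.
  by rewrite ler_wpM2l // lef_pV2 // posrE // (lt_le_trans sq_gt0).
rewrite -(inv_sq_out h_x); have [c_x|x_c] := leP c x.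
- have x_N2 : x \in N2.
    by move: h_x x_d; rewrite ger0_norm ?subr_ge0 // => ? ?;
       rewrite inE /N2 /= in_itv /=; apply/andP; split; lra.
  have := restr_ge0 N1; rewrite [(_ \_ N2) x]patchE x_N2; lra.
- have x_N1 : x \in N1.
    by move: h_x x_d; rewrite ltr0_norm ?subr_lt0 // => ? ?;
       rewrite inE /N1 /= in_itv /=; apply/andP; split; lra.
  have := restr_ge0 N2; rewrite [(_ \_ N1) x]patchE x_N1; lra.
Qed.

Let mitv (a b : R) : measurable `[a, b]%classic.
Proof. exact: measurable_itv. Qed.

Let integrable_restr (f : R -> R) (A : set R) (b : R) : measurable A ->
  measurable_fun setT f -> (forall x, `|f x| <= b) ->
  mu.-integrable S (EFin \o (f \_ A)).
Proof.
move=> mA mf f_le; apply: measurable_bounded_integrable.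
- exact: mitv.
- by apply: (le_lt_trans (probability_le1 mu (mitv _ _))); rewrite ltry.
- apply: measurable_funTS; apply/(measurable_restrictT _ _).1 => //.
  exact: measurable_funTS.
- exists `|b|; split => // z bz x _ /=; rewrite patchE.
  have z_ge : `|b| <= z := ltW bz.
  case: ifP => _; last by rewrite normr0 (le_trans _ z_ge).
  exact: le_trans (f_le x) (le_trans (ler_norm _) z_ge).
Qed.

Let Rintegral_restr (f : R -> R) (A : set R) : A `<=` S ->
  \int[mu]_(x in S) (f \_ A) x = \int[mu]_(x in A) f x.
Proof. by move=> AS; rewrite -Rintegral_mkcondr; congr Rintegral; exact/setIidr. Qed.

Lemma Rintegral_test_poly_le :
  \int[mu]_x (test_poly c h D j).[x] <=
  B * (d ^- 2 + 2 * M / h) - m * (2 * tau) * beta.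
Proof.
have [[hp hd] [hD ht]] := ((h_gt0, h_d), (d_D, tau_h)).
have beta_ge0 : 0 <= beta.
  rewrite mulr_ge0 ?exprn_ge0 // ?subr_ge0 ?lerXn2r ?nnegrE ?(ltW tau_gt0) //.
  exact: ltW.
have mS : measurable (S : set (measurableTypeR R)) by exact: mitv.
have sub_S p q : c - D <= p -> q <= c + D -> `[p, q]%classic `<=` S.
  move=> Dp qD x; rewrite /S /= !in_itv /= => /andP[px xq].
  by rewrite (le_trans Dp) // (le_trans xq).
have mJ : measurable (J : set (measurableTypeR R)) by exact: mitv.
have JS : J `<=` S by apply: sub_S; lra.
have N1S : N1 `<=` S by apply: sub_S; lra.
have N2S : N2 `<=` S by apply: sub_S; lra.
have int_beta : mu.-integrable S (EFin \o ((fun=> beta) \_ J)).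
  by apply: (@integrable_restr _ _ `|beta|); rewrite ?/J.
have int_inv p q : mu.-integrable S (EFin \o (inv_sq c h \_ `[p, q])).
  apply: (@integrable_restr _ _ (h ^- 2)) => //; first exact: measurable_inv_sq.
  by move=> x; rewrite ger0_norm ?inv_sq_le // ltW // inv_sq_gt0.
have int_B p q : mu.-integrable S (EFin \o (fun x => B * (inv_sq c h \_ `[p, q]) x)).
  exact: (integrableZl mS B (int_inv p q)).
have int_cst : mu.-integrable S (EFin \o (fun=> B * d ^- 2)).
  exact: finite_measure_integrable_cst.
have int_test : mu.-integrable S (EFin \o horner (test_poly c h D j)).
  by apply: integrableS (integrable_poly mu_out _).
have := @le_Rintegral _ _ _ mu S _ _ mS _ _ test_poly_le_step.
move=> /(_ (integrableD mS int_test int_beta)).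
move=> /(_ (integrableD mS int_cst (integrableD mS (int_B _ _) (int_B _ _)))).
have -> : \int[mu]_(x in S) ((test_poly c h D j).[x] + ((fun=> beta) \_ J) x) =
    \int[mu]_x (test_poly c h D j).[x] + beta * fine (mu J).
  rewrite RintegralD // (Rintegral_restr _ JS) (Rintegral_cst _ mJ).
  congr (_ + _).
  exact/esym/(Rintegral_poly_itv mu_out).
have -> : \int[mu]_(x in S)
    (B * d ^- 2 + (B * (inv_sq c h \_ N1) x + B * (inv_sq c h \_ N2) x)) =
    B * d ^- 2 * fine (mu S) + (B * \int[mu]_(x in N1) inv_sq c h x +
                                B * \int[mu]_(x in N2) inv_sq c h x).
  rewrite RintegralD //; last exact: (integrableD mS (int_B _ _) (int_B _ _)).
  rewrite RintegralD //; [|exact: int_B|exact: int_B].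
  rewrite [X in _ + (X + _) = _]RintegralZl //; last exact: int_inv.
  rewrite [X in _ + (_ + X) = _]RintegralZl //; last exact: int_inv.
  by rewrite (Rintegral_restr _ N1S) (Rintegral_restr _ N2S) (Rintegral_cst _ mS).
have := Rintegral_inv_sq_left h_gt0 h_d M_ge0 mu_le.
have := Rintegral_inv_sq_right h_gt0 h_d M_ge0 mu_le.
have mu_fin (A : set (measurableTypeR R)) : measurable A -> mu A \is a fin_num.
  by move=> mA; exact: fin_num_measure.
have muS_le1 : fine (mu S) <= 1.
  by rewrite -lee_fin fineK ?mu_fin // probability_le1.
have muJ_ge : m * (2 * tau) <= fine (mu J).
  by rewrite -lee_fin fineK ?mu_fin.
have := ler_wpM2l beta_ge0 muJ_ge.
have far_ge0 : 0 <= B * d ^- 2 by rewrite mulr_ge0 // invr_ge0 exprn_ge0 // ltW.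
have := ler_wpM2l far_ge0 muS_le1.
move=> ? ? /(ler_wpM2l B_ge0) ? /(ler_wpM2l B_ge0) ?.
lra.
Qed.
End IntegralOfTest.
(** * The integral as a positive functional on polynomials *)

Lemma finite_roots (R : realType) (f : {poly R}) : f != 0 ->
  finite_set [set x | root f x].
Proof.
move=> f_neq0; apply: contrapT => /(infinite_set_fset (size f))[B B_roots B_size].
have := max_poly_roots f_neq0 _ (finmap.fset_uniq B).
rewrite ltnNge => /(_ _)/negP; apply => //.
by apply/allP => x /B_roots.
Qed.

Section PolyIntegral.
Variables (R : realType) (mu : probability (measurableTypeR R) R) (lo hi : R).
Hypothesis mu_out : mu (~` `[lo, hi]%classic) = 0%E.
Local Notation L f := (\int[mu]_x (f : {poly R}).[x]).

Lemma Rintegral_poly_linear k (f g : {poly R}) :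
  L (k *: f + g) = k * L f + L g.
Proof.
have int_poly q := integrable_poly mu_out q.
rewrite -RintegralZl // -RintegralD //; last first.
  by have := int_poly (k *: f); congr (integrable _ _ _); apply/funext => x /=; rewrite hornerZ.
by apply: eq_Rintegral => x _; rewrite hornerD hornerZ.
Qed.

(** A nonnegative polynomial with integral zero vanishes almost everywhere, so
    the measure would live on its finitely many roots. *)
Lemma Rintegral_poly_gt0 (f : {poly R}) : nontrivial_measure mu ->
  f != 0 -> (forall x, 0 <= f.[x]) -> 0 < L f.
Proof.
move=> mu_nontrivial f_neq0 f_ge0.
rewrite lt_neqAle Rintegral_ge0 // andbT eq_sym; apply/eqP => Lf0.
apply: mu_nontrivial; exists [set x | root f x]; split; first exact: finite_roots.
have mf : measurable_fun setT (EFin \o horner f).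
  by apply/measurable_EFinP; exact: measurable_poly.
have int0 : (\int[mu]_x `|(EFin \o horner f) x| = 0)%E.
  under eq_integral do rewrite /= ger0_norm //.
  rewrite -[LHS]fineK ?[fine _]Lf0 //.
  exact: integrable_fin_num (integrable_poly mu_out f).
have [N [mN N0 subN]] := (ae_eq_integral_abs mu measurableT mf).1 int0.
have roots_meas : measurable (~` [set x : measurableTypeR R | root f x]).
  rewrite (_ : ~` _ = setT `&` [set x | (EFin \o horner f) x != 0%E]).
    exact: emeasurable_neq.
  apply/seteqP; split => x /=; first by move=> fx; split => //; apply/negP.
  by move=> [_ fx]; exact/negP.
apply/eqP; rewrite -measure_le0 -N0.
apply: le_measure; [exact: mem_set|exact: mem_set|].
move=> x fx; apply: subN => /= /(_ Logic.I) [fx0]; apply: fx; exact/eqP.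
Qed.

(** [p 0], ..., [p (n - 1)] span the polynomials of degree less than [n]: subtract
    the multiple of [p k] that kills the coefficient of index [k]. *)
Lemma Rintegral_poly_orth (p : nat -> {poly R}) (n : nat) (g : {poly R}) :
  orthonormal_polys mu p -> (size g <= n)%N -> L (p n * g) = 0.
Proof.
move=> [size_p p_orth] size_g.
suff : forall k (q : {poly R}), (k <= n)%N -> (size q <= k)%N -> L (p n * q) = 0.
  by apply; [exact: leqnn|].
elim=> [|k IH] q k_n size_q.
  have /eqP -> : q == 0 by rewrite -size_poly_leq0.
  rewrite mulr0; under eq_Rintegral do rewrite horner0.
  by rewrite Rintegral_cst // mul0r.
pose c := q`_k / lead_coef (p k).
have Lpp : L (p n * p k) = 0.
  rewrite /Rintegral; under eq_integral do rewrite hornerM.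
  by rewrite p_orth gtn_eqF.
have pk_neq0 : lead_coef (p k) != 0.
  by rewrite lead_coef_eq0 -size_poly_eq0 size_p.
have size_q' : (size (q - c *: p k)%R <= k)%N.
  apply/leq_sizeP => i k_i; rewrite coefB coefZ.
  have [->|k_neq_i] := eqVneq i k.
    have pkk : (p k)`_k = lead_coef (p k) by rewrite lead_coefE size_p.
    by rewrite pkk divfK // subrr.
  have k_lt_i : (k < i)%N by rewrite ltn_neqAle eq_sym k_neq_i.
  rewrite !nth_default ?mulr0 ?subr0 ?size_p //.
  exact: leq_trans k_lt_i.
have -> : p n * q = c *: (p n * p k) + p n * (q - c *: p k).
  by rewrite mulrBr -scalerAr addrC subrK.
by rewrite Rintegral_poly_linear Lpp mulr0 add0r IH // ltnW.
Qed.
End PolyIntegral.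
(** * Support and density *)

Lemma compact_has_bounds (R : realType) (A : set R) : compact A ->
  has_lbound A /\ has_ubound A.
Proof.
move=> /compact_bounded[B [_ A_le]].
have {}A_le x : A x -> `|x| <= `|B| + 1.
  by apply: A_le; rewrite (le_lt_trans (ler_norm _)) // ltrDl.
split; first by exists (- (`|B| + 1)) => x /A_le; rewrite ler_norml => /andP[].
by exists (`|B| + 1) => x /A_le; apply: le_trans; exact: ler_norm.
Qed.

Section Support.
Variables (R : realType) (mu : probability (measurableTypeR R) R).

(** Every point outside the support lies in a null interval with rational
    endpoints, and there are countably many of these. *)
Lemma msupp_null (A : set (measurableTypeR R)) : measurable A -> A `&` msupp mu = set0 ->
  mu A = 0%E.
Proof.
move=> mA A_out.
pose I (q : rat * rat) : set (measurableTypeR R) := `](ratr q.1 : R), (ratr q.2 : R)[%classic.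
pose Q := [set q | mu (I q) = 0%E].
pose U := \bigcup_(q in Q) I q.
have U_null : mu.-negligible U.
  have -> : U = \bigcup_n (if unpickle n is Some q then
      (if `[< Q q >] then I q else set0) else set0).
    apply/seteqP; split => [x [q Qq Iqx]|x [n _]].
      exists (pickle q); first exact: Logic.I.
      by rewrite pickleK asboolT.
    by case: unpickle => // q; case: asboolP => // Qq Iqx; exists q.
  apply: negligible_bigcup => n; case: unpickle => [q|]; last exact: negligible_set0.
  case: asboolP => [Qq|_]; last exact: negligible_set0.
  by exists (I q); split => //; exact: measurable_itv.
apply/(negligibleP _ mA); apply: negligibleS U_null => x Ax.
have /existsNP[V] : ~ msupp mu x.
  by move=> x_supp; have : (A `&` msupp mu) x by []; rewrite A_out.
move=> /not_implyP[V_open /not_implyP[Vx /negP]]; rewrite -leNgt measure_le0 => /eqP V0.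
have [e /= e_gt0 ball_V] := open_nbhs_nbhs (conj V_open Vx).
have [q1 q1_itv] := @rat_in_itvoo R (x - e) x (ltac:(rewrite gtrBl; exact: e_gt0)).
have [q2 q2_itv] := @rat_in_itvoo R x (x + e) (ltac:(rewrite ltrDl; exact: e_gt0)).
move: q1_itv q2_itv; rewrite !in_itv /= => /andP[xe_q1 q1_x] /andP[x_q2 q2_xe].
exists (q1, q2); last by rewrite /I /= in_itv /= q1_x.
apply/eqP; rewrite -measure_le0 -V0; apply: le_measure.
- by apply: mem_set; exact: measurable_itv.
- by apply: mem_set; exact: open_measurable.
move=> y; rewrite /I /= in_itv /= => /andP[q1_y y_q2]; apply: ball_V => /=.
rewrite ltr_norml; apply/andP; split; lra.
Qed.

Lemma msupp_hull E : compact (msupp mu) -> msupp mu E ->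
  mu (~` `[E - dist_ends mu E, E + dist_ends mu E]%classic) = 0%E.
Proof.
move=> /compact_has_bounds[lb ub] E_supp.
apply: msupp_null; first by apply: measurableC; exact: measurable_itv.
apply/seteqP; split => // x [/= x_out x_supp]; apply: x_out.
have := ub_le_sup ub x_supp; have := ge_inf lb x_supp.
rewrite in_itv /= /dist_ends.
set s := sup _; set i := inf _ => i_x x_s.
have : s - E <= Num.max (s - E) (E - i) by rewrite le_max lexx.
have : E - i <= Num.max (s - E) (E - i) by rewrite le_max lexx orbT.
by move=> ? ?; apply/andP; split; lra.
Qed.

Variables (a b : R) (w : R -> R).
Hypothesis mu_density : has_density_on mu a b w.

Lemma density_bounds (A : set R) (m M : R) : measurable A ->
  A `<=` `[a, b]%classic -> 0 <= m -> (forall x, A x -> m <= w x <= M) ->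
  (m%:E * @lebesgue_measure R A <= mu A)%E /\
  (mu A <= M%:E * @lebesgue_measure R A)%E.
Proof.
move=> mA A_ab m_ge0 w_bnd; have [mw mu_eq] := mu_density.
have mwA : measurable_fun A (fun x => (w x)%:E).
  by apply/measurable_EFinP; apply: measurable_funS mw => //; exact: measurable_itv.
rewrite mu_eq // -!integral_cst //; split; apply: ge0_le_integral => //.
- by move=> x Ax; rewrite lee_fin; have /andP[] := w_bnd x Ax.
- by move=> x Ax; rewrite lee_fin; have /andP[+ _] := w_bnd x Ax; apply: le_trans.
- by move=> x Ax; rewrite lee_fin; have /andP[] := w_bnd x Ax.
Qed.

Hypothesis w_lower : 0 < inf [set w x | x in `[a, b]%classic].

(** A set of reals without a lower bound has infimum 0 by convention, so the
    positivity of the infimum provides a lower bound. *)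
Lemma density_ge x : x \in `[a, b] ->
  inf [set w x | x in `[a, b]%classic] <= w x.
Proof.
move=> x_ab; apply: ge_inf; last by exists x.
apply: contrapT => no_lb; move: w_lower.
by rewrite inf_out ?ltxx // => -[].
Qed.

Hypothesis w_upper : has_ubound [set w x | x in `[a, b]%classic].

Lemma msupp_interior x : x \in `]a, b[ -> msupp mu x.
Proof.
move=> x_ab U U_open Ux.
have m_gt0 := w_lower; set m := inf _ in m_gt0.
have [B w_le] := w_upper.
have [e /= e_gt0 ball_U] := open_nbhs_nbhs (conj U_open Ux).
move: x_ab; rewrite in_itv /= => /andP[a_x x_b].
pose r := Num.min (e / 2) (Num.min (x - a) (b - x)).
have r_gt0 : 0 < r by rewrite !lt_min !subr_gt0 a_x x_b divr_gt0.
have r_e : r <= e / 2 by rewrite ge_min lexx.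
have r_a : r <= x - a by rewrite !ge_min lexx orbT.
have r_b : r <= b - x by rewrite !ge_min lexx !orbT.
pose V := `[x - r, x + r]%classic.
have mV : measurable V by exact: measurable_itv.
have V_ab : V `<=` `[a, b]%classic.
  by move=> y; rewrite /V /= !in_itv /= => /andP[? ?]; apply/andP; split; lra.
have [] := density_bounds (m := m) (M := B) mV V_ab (ltW m_gt0).
  by move=> y /V_ab y_ab; rewrite density_ge //= w_le //; exists y.
move=> mu_V _; apply: (@lt_le_trans _ _ (mu V)).
  apply: lt_le_trans mu_V; rewrite lebesgue_measure_itv /= lte_fin.
  by rewrite ifT -?EFinD -?EFinM ?lte_fin ?mulr_gt0 //; lra.
apply: le_measure; [exact: mem_set|apply: mem_set; exact: open_measurable|].
move=> y; rewrite /V /= in_itv /= => /andP[xr_y y_xr]; apply: ball_U => /=.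
by rewrite ltr_norml; apply/andP; split; lra.
Qed.
End Support.
(** * The oscillation ratio *)

Section OscillationRatio.
Variables (R : realType) (a b : R) (w : R -> R) (E : R).
Hypothesis w_lower : 0 < inf [set w x | x in `[a, b]%classic].
Hypothesis w_upper : has_ubound [set w x | x in `[a, b]%classic].
Hypothesis E_int : E \in `]a, b[.
Local Notation W d := [set w x | x in [set x | `|x - E| < d]].
Let r0 := Num.min (E - a) (b - E).

Let r0_gt0 : 0 < r0.
Proof. by move: E_int; rewrite in_itv /= lt_min !subr_gt0. Qed.

Lemma near_center_in_itv d x : d <= r0 -> `|x - E| < d -> x \in `[a, b].
Proof.
rewrite le_min => /andP[da db]; rewrite ltr_norml => /andP[dx xd].
by rewrite in_itv /=; apply/andP; split; lra.
Qed.

Lemma osc_bounds d : 0 < d -> d <= r0 ->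
  0 < inf (W d) /\ (forall x, `|x - E| < d -> inf (W d) <= w x <= sup (W d)).
Proof.
move=> d_gt0 d_r0.
have W_neq0 : W d !=set0 by exists (w E); exists E => //=; rewrite subrr normr0.
have W_lb : lbound (W d) (inf [set w x | x in `[a, b]%classic]).
  by move=> _ [x x_E <-]; apply: density_ge => //; exact: near_center_in_itv x_E.
have W_ub : has_ubound (W d).
  have [B w_le] := w_upper; exists B => _ [x x_E <-]; apply: w_le.
  by exists x => //; exact: near_center_in_itv x_E.
split=> [|x x_E]; first by apply: lt_le_trans w_lower (lb_le_inf W_neq0 W_lb).
have Wx : W d (w x) by exists x.
by rewrite ub_le_sup // ge_inf //; exists (inf [set w x | x in `[a, b]%classic]).
Qed.

Lemma osc_ratio_ge1 d : 0 < d -> d <= r0 -> 1 <= osc_ratio w E d.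
Proof.
move=> d_gt0 d_r0; have [inf_gt0 w_bnd] := osc_bounds d_gt0 d_r0.
rewrite /osc_ratio ler_pdivlMr // mul1r.
have /andP[] : inf (W d) <= w E <= sup (W d) by apply: w_bnd; rewrite subrr normr0.
exact: le_trans.
Qed.

Lemma osc_ratio_le d m M : 0 < d -> d <= r0 -> 0 < m ->
  (forall x, `|x - E| < d -> m <= w x <= M) -> osc_ratio w E d <= M / m.
Proof.
move=> d_gt0 d_r0 m_gt0 w_bnd; have [inf_gt0 _] := osc_bounds d_gt0 d_r0.
have W_neq0 : W d !=set0 by exists (w E); exists E => //=; rewrite subrr normr0.
have m_inf : m <= inf (W d).
  by apply: lb_le_inf => // _ [x x_E <-]; have /andP[] := w_bnd x x_E.
have sup_M : sup (W d) <= M.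
  by apply: ge_sup => // _ [x x_E <-]; have /andP[] := w_bnd x x_E.
have sup_ge0 : 0 <= sup (W d).
  have := osc_ratio_ge1 d_gt0 d_r0; rewrite /osc_ratio ler_pdivlMr // mul1r.
  by apply: le_trans; exact: ltW.
by rewrite /osc_ratio ler_pM ?invr_ge0 ?(ltW inf_gt0) // lef_pV2 // posrE.
Qed.

Lemma osc_ratio_mono d e : 0 < d -> d <= e -> e <= r0 ->
  osc_ratio w E d <= osc_ratio w E e.
Proof.
move=> d_gt0 d_e e_r0.
have [inf_gt0 w_bnd] := osc_bounds (lt_le_trans d_gt0 d_e) e_r0.
apply: osc_ratio_le => //; first exact: le_trans d_e e_r0.
by move=> x x_d; apply: w_bnd; exact: lt_le_trans x_d d_e.
Qed.

Lemma near_osc_radius : \forall d \near 0^'+, 0 < d /\ d <= r0.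
Proof.
by near=> d; split; near: d; [exact: nbhs_right_gt|exact: nbhs_right_le].
Unshelve. all: by end_near. Qed.

Lemma cvg_osc_ratio : cvg (osc_ratio w E d @[d --> 0^'+]).
Proof.
apply: nondecreasing_at_right_is_cvgr; near=> e.
- move=> d d'; rewrite !in_itv /= => /andP[d_gt0 _] /andP[_ d'_e] dd'.
  apply: osc_ratio_mono => //; apply: (le_trans (ltW d'_e)).
  by near: e; exact: nbhs_right_le.
- exists 1 => _ [d + <-]; rewrite /= in_itv /= => /andP[d_gt0 d_e].
  apply: osc_ratio_ge1 => //; apply: (le_trans (ltW d_e)).
  by near: e; exact: nbhs_right_le.
Unshelve. all: by end_near. Qed.

Lemma lim_osc_ratio_ge1 : 1 <= lim (osc_ratio w E d @[d --> 0^'+]).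
Proof.
apply: limr_ge; first exact: cvg_osc_ratio.
by apply: filterS near_osc_radius => d [? ?]; exact: osc_ratio_ge1.
Qed.

Lemma osc_ratio_near_lim B : lim (osc_ratio w E d @[d --> 0^'+]) < B ->
  exists d, [/\ 0 < d, d <= r0 & osc_ratio w E d <= B].
Proof.
move=> lim_B.
have : \forall d \near 0^'+, osc_ratio w E d <= B.
  by apply: (cvgr_le _ cvg_osc_ratio).
by move=> /(filterI near_osc_radius) /filter_ex[d [[? ?] ?]]; exists d.
Qed.

Lemma lim_osc_ratio_le1 : {for E, continuous w} ->
  lim (osc_ratio w E d @[d --> 0^'+]) <= 1.
Proof.
move=> w_cont; apply/ler_addgt0Pr => eta eta_gt0.
have wE_gt0 : 0 < w E.
  apply: (lt_le_trans w_lower); apply: density_ge => //.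
  exact: subset_itv_oo_cc.
(* Solves (w E + eps) / (w E - eps) = 1 + eta. *)
pose eps := w E * eta / (2 + eta).
have eps_gt0 : 0 < eps by rewrite divr_gt0 ?mulr_gt0 // addr_gt0.
apply: limr_le; first exact: cvg_osc_ratio.
have /cvgrPdist_le /(_ _ eps_gt0) := w_cont.
move=> /nbhs_ballP[e /= e_gt0 w_near].
near=> d.
have d_gt0 : 0 < d by near: d; exact: nbhs_right_gt.
have d_r0 : d <= r0 by near: d; exact: nbhs_right_le.
have d_e : d <= e by near: d; exact: nbhs_right_le.
have -> : 1 + eta = (w E + eps) / (w E - eps).
  rewrite /eps; field.
  by apply/andP; split; rewrite gt_eqF //; nra.
apply: osc_ratio_le => //.
  rewrite subr_gt0 /eps ltr_pdivrMr ?addr_gt0 // ltr_pM2l //; lra.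
move=> x x_d; have : `|w E - w x| <= eps.
  by apply: w_near; rewrite /ball /= distrC; exact: lt_le_trans x_d d_e.
by rewrite ler_norml => /andP[? ?]; apply/andP; split; lra.
Unshelve. all: by end_near. Qed.
End OscillationRatio.
(** * Zeros in windows of length [C / n] *)

(** In units of [s^3 m], the far part is at most [1], the near part at most
    [2 (11 / 10) / (9 / 5) = 11 / 9], and the core at least
    [((9 / 5)^2 - 1 / 4) (23 / 24)^4 > 12 / 5]. *)
Lemma test_value_lt0 (R : realType) (s d m M rho h : R) :
  0 < s -> 0 < d -> 0 < m -> 0 <= M -> 1 <= rho -> M <= 11 / 10 * rho * m ->
  9 / 5 * rho * s <= h -> s <= m * d ^+ 2 ->
  s ^+ 4 * (d ^- 2 + 2 * M / h) -
    m * s * ((h ^+ 2 - (s / 2) ^+ 2) * (23 / 24) ^+ 4) < 0.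
Proof.
move=> s_gt0 d_gt0 m_gt0 M_ge0 rho_ge1 M_le h_ge s_le.
have rho_gt0 : 0 < rho by lra.
have h_gt0 : 0 < h by apply: lt_le_trans h_ge; rewrite !mulr_gt0.
pose t := s ^+ 3 * m.
have t_gt0 : 0 < t by rewrite mulr_gt0 ?exprn_gt0.
have far : s ^+ 4 * d ^- 2 <= t.
  rewrite ler_pdivrMr ?exprn_gt0 // /t -mulrA [s ^+ 4]exprSr.
  by rewrite ler_wpM2l // exprn_ge0 // ltW.
have near : s ^+ 4 * (2 * M / h) <= 11 / 9 * t.
  rewrite mulrA ler_pdivrMr //.
  apply: (@le_trans _ _ (11 / 9 * t * (9 / 5 * rho * s))); last first.
    by rewrite ler_wpM2l // mulr_ge0 // ltW.
  have -> : 11 / 9 * t * (9 / 5 * rho * s) = s ^+ 4 * (2 * (11 / 10 * rho * m)).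
    by rewrite /t; field.
  by rewrite !ler_wpM2l // exprn_ge0 // ltW.
have core : 6 / 5 * 2 * t <= m * s * ((h ^+ 2 - (s / 2) ^+ 2) * (23 / 24) ^+ 4).
  have h2 : (9 / 5 * s) ^+ 2 <= h ^+ 2.
    have s_rho : s <= rho * s by rewrite ler_peMl // ltW.
    by rewrite lerXn2r ?nnegrE //; lra.
  have -> : 6 / 5 * 2 * t = m * s * (s ^+ 2 * (12 / 5)) by rewrite /t; field.
  rewrite ler_wpM2l ?mulr_ge0 ?(ltW s_gt0) ?(ltW m_gt0) //.
  have : 3 * s ^+ 2 - (s / 10) ^+ 2 <= h ^+ 2 - (s / 2) ^+ 2 by move: h2; lra.
  have := sqr_ge0 s; lra.
rewrite mulrDr; lra.
Qed.

(** The test polynomial has degree [8 j + 2] and must stay below [2 n], so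
    [K = 2 j + 1] is at best about [n / 2]; [12 / 25] is a convenient fraction
    just below one half. *)
Lemma kernel_degree (n : nat) : (75 <= n)%N ->
  exists j, (8 * j + 3 <= n.*2)%N /\ (12 * n <= 25 * j.*2.+1)%N.
Proof.
move=> n_ge; exists ((n.*2 - 3) %/ 8)%N.
have := leq_divM (n.*2 - 3) 8; have := @ltn_ceil (n.*2 - 3) 8 isT.
set q := (_ %/ 8)%N; rewrite -!muln2.
clearbody q; move: n_ge => n_ge lo hi; split; lia.
Qed.

Section ZerosInWindows.
Variables (R : realType) (mu : probability (measurableTypeR R) R).
Variables (p : nat -> {poly R}) (a b : R) (w : R -> R) (E : R).
Hypothesis mu_nontrivial : nontrivial_measure mu.
Hypothesis mu_compact : compactly_supported mu.
Hypothesis p_orthonormal : orthonormal_polys mu p.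
Hypothesis mu_ac : has_density_on mu a b w.
Hypothesis w_lower : 0 < inf [set w x | x in `[a, b]%classic].
Hypothesis w_upper : has_ubound [set w x | x in `[a, b]%classic].
Hypothesis E_int : E \in `]a, b[.
Local Notation rho := (lim (osc_ratio w E delta @[delta --> 0^'+])).
Local Notation d0 := (dist_ends mu E).

Lemma dist_ends_gt0 : 0 < d0.
Proof.
have := E_int; rewrite in_itv /= => /andP[a_E E_b].
have e_int : (E + b) / 2 \in `]a, b[ by rewrite in_itv /=; apply/andP; split; lra.
have e_supp := msupp_interior mu_ac w_lower w_upper e_int.
rewrite lt_max; apply/orP; left.
have [_ ub] := compact_has_bounds mu_compact.
have := ub_le_sup ub e_supp; lra.
Qed.

Lemma dist_ends_null : mu (~` `[E - d0, E + d0]%classic) = 0%E.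
Proof. by apply: msupp_hull => //; exact: (msupp_interior mu_ac). Qed.

(** A test polynomial is nonnegative at distance [h] or more from its centre, so
    a negative integral is incompatible with the quadrature formula unless some
    node is closer. *)
Lemma zero_of_negative_test c h D (j n : nat) : 0 < h ->
  (8 * j + 3 <= n.*2)%N -> \int[mu]_x (test_poly c h D j).[x] < 0 ->
  exists2 z, root (p n) z & `|z - c| < h.
Proof.
move=> h_gt0 j_n test_lt0; apply: contrapT => no_zero.
move: test_lt0; rewrite ltNge => /negP; apply.
have mu_out := dist_ends_null.
have [size_p _] := p_orthonormal.
apply: (@quadrature_ge0 R (fun f => \int[mu]_x f.[x]) _ _ n (p n)).
- exact: Rintegral_poly_linear mu_out.
- by move=> f; exact: (@Rintegral_poly_gt0 _ _ _ _ mu_out f mu_nontrivial).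
- exact: size_p.
- by move=> g; exact: Rintegral_poly_orth mu_out _ _ _ p_orthonormal.
- exact: leq_trans (size_test_poly _ _ _ _) j_n.
move=> x p_x; rewrite horner_test_poly mulr_ge0 ?exprn_even_ge0 // subr_ge0.
rewrite -[leRHS]real_normK ?num_real // lerXn2r ?nnegrE ?(ltW h_gt0) //.
by rewrite leNgt; apply/negP => x_c; apply: no_zero; exists x.
Qed.

(** The centre [c] is within [d0 / 20] of [E], so [D = 21 / 20 d0] is enough for
    [[c - D, c + D]] to contain the support. *)
Lemma negative_test (r e d m M c h : R) (j : nat) :
  let s := 21 / 20 * d0 / j.*2.+1%:R in
  0 < m -> 0 <= M -> 1 <= r -> M <= 11 / 10 * r * m ->
  (forall x, `|x - E| < e -> x \in `[a, b] /\ m <= w x <= M) ->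
  0 < d -> d <= e / 2 -> d <= d0 -> `|c - E| <= h -> h <= d0 / 20 -> h < d ->
  9 / 5 * r * s <= h -> s <= m * d ^+ 2 ->
  \int[mu]_x (test_poly c h (21 / 20 * d0) j).[x] < 0.
Proof.
move=> s m_gt0 M_ge0 r_ge1 M_le w_bnd d_gt0 d_e d_d0 c_E h_d0 h_d h_ge s_le.
have d0_gt0 := dist_ends_gt0.
set D := 21 / 20 * d0 in s s_le h_ge *.
have D_gt0 : 0 < D by rewrite mulr_gt0.
have s_gt0 : 0 < s by rewrite divr_gt0 // ltr0n.
have s_h : s <= h.
  by apply: le_trans h_ge; rewrite ler_peMl ?(ltW s_gt0) //; lra.
have tauE : s / 2 = D / (2 * j.*2.+1%:R) by rewrite /s; field.
move: c_E; rewrite ler_norml => /andP[E_c c_E].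
have itv_sub x y x' y' : x' <= x -> y <= y' -> `[x, y]%classic `<=` `[x', y']%classic.
  move=> xx yy z; rewrite /= !in_itv /= => /andP[xz zy].
  by rewrite (le_trans xx) // (le_trans zy).
have mu_out : mu (~` `[c - D, c + D]%classic) = 0%E.
  apply/eqP; rewrite -measure_le0 -dist_ends_null.
  apply: le_measure; [apply: mem_set|apply: mem_set|].
  - by apply: measurableC; exact: measurable_itv.
  - by apply: measurableC; exact: measurable_itv.
  by apply: subsetC; apply: itv_sub; rewrite /D; lra.
have dens A : measurable A -> A `<=` `[c - d, c + d]%classic ->
    (m%:E * @lebesgue_measure R A <= mu A)%E /\
    (mu A <= M%:E * @lebesgue_measure R A)%E.
  move=> mA A_d; have A_e x : A x -> `|x - E| < e.
    move=> /A_d; rewrite /= in_itv /= => /andP[cd_x x_cd].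
    by rewrite ltr_norml; apply/andP; split; lra.
  apply: (density_bounds mu_ac) => //; last by move=> x /A_e /w_bnd[].
  - by move=> x /A_e /w_bnd[].
  - exact: ltW.
have mu_le A : measurable A -> A `<=` `[c - d, c + d]%classic ->
    (mu A <= M%:E * @lebesgue_measure R A)%E.
  by move=> mA A_d; have [] := dens A mA A_d.
have mu_ge : ((m * (2 * (s / 2)))%:E <= mu `[(c - s / 2)%R, (c + s / 2)%R]%classic)%E.
  have [|] := dens `[c - s / 2, c + s / 2]%classic (measurable_itv _).
    by apply: itv_sub; lra.
  move=> + _; apply: le_trans; rewrite lebesgue_measure_itv /= lte_fin ifT; last lra.
  by rewrite -EFinD -EFinM; have -> : c + s / 2 - (c - s / 2) = 2 * (s / 2) by ring.
apply: le_lt_trans (Rintegral_test_poly_le tauE _ _ h_d _ M_ge0 mu_out mu_le mu_ge) _.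
- by rewrite divr_gt0.
- by lra.
- by rewrite /D; lra.
have -> : 2 * (s / 2) = s by field.
exact: (test_value_lt0 s_gt0 d_gt0 m_gt0 M_ge0 r_ge1).
Qed.

(** The constants fit: from [12 / 25 nu <= K] follows [s <= 35 / 16 d0 / nu],
    while [h >= 4 d0 r / nu], and [9 / 5 * 35 / 16 = 63 / 16 < 4]. *)
Lemma window_scales (nu K C r d m : R) : 0 < nu -> 0 < d -> 0 < m -> 1 <= r ->
  8 * d0 * r <= C -> 12 * nu <= 25 * K ->
  10 * C / d0 <= nu -> C / d <= nu -> 3 * d0 / (m * d ^+ 2) <= nu ->
  let h := C / (2 * nu) in let s := 21 / 20 * d0 / K in
  [/\ h <= d0 / 20, h < d, 9 / 5 * r * s <= h & s <= m * d ^+ 2].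
Proof.
move=> nu_gt0 d_gt0 m_gt0 r_ge1 C_ge K_ge nu1 nu2 nu3 h s.
have d0_gt0 := dist_ends_gt0.
have K_gt0 : 0 < K by lra.
have s_nu : s * nu <= 35 / 16 * d0.
  rewrite /s mulrAC ler_pdivrMr //.
  by have := ler_wpM2l (ltW d0_gt0) K_ge; lra.
have h_nu : h * nu = C / 2 by rewrite /h; field; rewrite gt_eqF.
have rd_ge0 : 0 <= r * d0 by rewrite mulr_ge0 ?(ltW d0_gt0) //; lra.
have C_gt0 : 0 < C.
  by apply: lt_le_trans C_ge; rewrite !mulr_gt0 //; lra.
split; rewrite -(ler_pM2r nu_gt0) || rewrite -(ltr_pM2r nu_gt0); rewrite ?h_nu.
- by move: nu1; rewrite ler_pdivrMr //; lra.
- by move: nu2; rewrite ler_pdivrMr //; lra.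
- have r_ge0 : 0 <= r by lra.
  rewrite -mulrA; have := ler_wpM2l r_ge0 s_nu; lra.
- apply: (le_trans s_nu); move: nu3.
  by rewrite ler_pdivrMr ?mulr_gt0 ?exprn_gt0 // mulrC; lra.
Qed.

(** The radius [e] is chosen so that the extrema [m] and [M] of the density on
    the window of radius [e] around [E] have ratio at most [11 / 10 rho]; for large
    [n] the interval between [u] and [v] lies well inside that window. *)
Lemma zero_in_window (C : R) : 4 * pi * d0 * rho < C ->
  \forall n \near \oo, (0 < n)%N /\ forall u v, u <= E <= v -> v - u = C / n%:R ->
    exists z, [/\ root (p n) z, u < z & z < v].
Proof.
move=> C_gt; have d0_gt0 := dist_ends_gt0.
have rho_ge1 : 1 <= rho by exact: lim_osc_ratio_ge1 w_lower w_upper E_int.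
have C_ge : 8 * d0 * rho <= C.
  apply: le_trans (ltW C_gt); rewrite ler_wpM2r //; first lra.
  by rewrite ler_wpM2r ?(ltW d0_gt0) //; have := pi_ge2 R; lra.
have C_gt0 : 0 < C by apply: lt_le_trans C_ge; rewrite !mulr_gt0 //; lra.
have [e [e_gt0 e_r0 osc_e]] : exists e, [/\ 0 < e, e <= Num.min (E - a) (b - E) &
    osc_ratio w E e <= 11 / 10 * rho].
  by apply: (osc_ratio_near_lim w_lower w_upper E_int); lra.
have [m_gt0 w_bnd] := osc_bounds w_lower w_upper e_gt0 e_r0.
set m := inf _ in m_gt0 w_bnd; set M := sup _ in w_bnd.
have M_le : M <= 11 / 10 * rho * m by rewrite -ler_pdivrMr.
have M_ge0 : 0 <= M.
  have /andP[m_w w_M] : m <= w E <= M by apply: w_bnd; rewrite subrr normr0.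
  by apply: le_trans (ltW m_gt0) (le_trans m_w w_M).
pose d := Num.min (e / 2) d0.
have d_gt0 : 0 < d by rewrite lt_min d0_gt0 divr_gt0.
have d_e : d <= e / 2 by rewrite ge_min lexx.
have d_d0 : d <= d0 by rewrite ge_min lexx orbT.
near=> n.
have n_ge75 : (75 <= n)%N by near: n; exact: nbhs_infty_ge.
have n_gt0 : 0 < n%:R :> R by rewrite ltr0n; apply: leq_trans n_ge75.
split; first by apply: leq_trans n_ge75.
move=> u v /andP[u_E E_v] uv.
have [j [j_size j_large]] := kernel_degree n_ge75.
have K_ge : 12 * n%:R <= 25 * j.*2.+1%:R :> R by rewrite -!natrM ler_nat.
have n1 : 10 * C / d0 <= n%:R by near: n; exact: nbhs_infty_ger.
have n2 : C / d <= n%:R by near: n; exact: nbhs_infty_ger.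
have n3 : 3 * d0 / (m * d ^+ 2) <= n%:R by near: n; exact: nbhs_infty_ger.
have [h_d0 h_d h_ge s_le] :=
  window_scales n_gt0 d_gt0 m_gt0 rho_ge1 C_ge K_ge n1 n2 n3.
set h := C / _ in h_d0 h_d h_ge; pose c := (u + v) / 2.
have h_uv : v - u = 2 * h by rewrite uv /h; field; rewrite gt_eqF.
have c_E : `|c - E| <= h.
  by rewrite /c; rewrite ler_norml; apply/andP; split; lra.
have h_gt0 : 0 < h by rewrite divr_gt0 // mulr_gt0.
have test_lt0 : \int[mu]_x (test_poly c h (21 / 20 * d0) j).[x] < 0.
  apply: (@negative_test rho e d m M) => // x x_e.
  by split; [exact: near_center_in_itv x_e|exact: w_bnd].
have [z p_z] := zero_of_negative_test h_gt0 j_size test_lt0.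
rewrite ltr_norml => /andP[h_z z_h]; exists z; split => //.
- by move: h_z; rewrite /c; lra.
- by move: z_h; rewrite /c; lra.
Unshelve. all: by end_near. Qed.
End ZerosInWindows.
(** * Neighbouring zeros and the upper limit *)

Lemma seq_extremum (T : eqType) (r : rel T) (s : seq T) (x0 : T) :
  total r -> transitive r -> x0 \in s ->
  exists2 z, z \in s & {in s, forall y, r z y}.
Proof.
move=> r_tot r_trans; elim: s x0 => // x [|y s] IH x0 _.
  exists x; first exact: mem_head.
  by move=> z; rewrite inE => /eqP ->; have /orP[] := r_tot x x.
have [z z_s z_ext] := IH y (mem_head y s).
have [x_z|z_x] := boolP (r x z).
  exists x; first exact: mem_head.
  move=> t; rewrite in_cons => /orP[/eqP ->|/z_ext]; last exact: r_trans.
  by have /orP[] := r_tot x x.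
exists z; first by rewrite in_cons z_s orbT.
move=> t; rewrite in_cons => /orP[/eqP ->|/z_ext //].
by have := r_tot x z; rewrite (negPf z_x).
Qed.

Section NeighboringZeros.
Variables (R : realType) (q : {poly R}) (E : R).
Hypothesis q_neq0 : q != 0.

Let extremal_root (r : rel R) (P : set R) : total r -> transitive r ->
  (exists2 z, root q z & P z) ->
  exists z, [/\ root q z, P z & forall y, root q y -> P y -> r z y].
Proof.
move=> r_tot r_trans [z0 q_z0 P_z0].
have /finite_seqP[F rootsE] := finite_roots q_neq0.
have mem_F y : root q y = (y \in F).
  apply/idP/idP => [qy|yF]; first by change ([set` F] y); rewrite -rootsE.
  by change ([set x | root q x] y); rewrite rootsE.
have z0_in : z0 \in [seq y <- F | `[< P y >]].
  by rewrite mem_filter -mem_F q_z0 andbT; exact/asboolP.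
have [z + z_ext] := seq_extremum r_tot r_trans z0_in.
rewrite mem_filter -mem_F => /andP[/asboolP Pz qz]; exists z; split => // y qy Py.
by apply: z_ext; rewrite mem_filter -mem_F qy andbT; exact/asboolP.
Qed.

Lemma zero_leP : (exists2 z, root q z & z <= E) ->
  [/\ root q (zero_le q E), zero_le q E <= E &
      forall z, root q z -> z <= E -> z <= zero_le q E].
Proof.
have ge_total : total (>=%R : rel R) by move=> x y; exact: le_total.
have ge_trans : transitive (>=%R : rel R) by move=> x y z yx xz; exact: le_trans xz yx.
move=> /(extremal_root ge_total ge_trans)[z [qz zE z_max]].
rewrite /zero_le; set Z := [set z | _].
have [|[q_le le_E] le_ub] := @xgetPex _ 0 (Z `&` ubound Z).
  by exists z; split; [split|move=> y [qy yE]; exact: z_max].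
by split => // y qy yE; apply: le_ub.
Qed.

Lemma zero_gtP : (exists2 z, root q z & E < z) ->
  [/\ root q (zero_gt q E), E < zero_gt q E &
      forall z, root q z -> E < z -> zero_gt q E <= z].
Proof.
move=> /(extremal_root (@le_total _ R) (@le_trans _ R))[z [qz zE z_min]].
rewrite /zero_gt; set Z := [set z | _].
have [|[q_gt gt_E] gt_lb] := @xgetPex _ 0 (Z `&` lbound Z).
  by exists z; split; [split|move=> y [qy yE]; exact: z_min].
by split => // y qy yE; apply: gt_lb.
Qed.

(** The windows that end and start at [E] show that both zeros exist.  If they
    were more than [l] apart, a window of length [l] around [E] would fit
    between them, and the zero in it would be closer to [E] than its neighbour
    on the same side. *)
Lemma zero_gap_le l : 0 < l ->
  (forall u v, u <= E <= v -> v - u = l -> exists z, [/\ root q z, u < z & z < v]) ->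
  zero_gt q E - zero_le q E <= l.
Proof.
move=> l_gt0 window.
have [||z1 [q_z1 _ z1_E]] := window (E - l) E; [by lra|by lra|].
have [||z2 [q_z2 E_z2 _]] := window E (E + l); [by lra|by lra|].
have [_ le_E zm_max] := zero_leP (ex_intro2 _ _ z1 q_z1 (ltW z1_E)).
have [_ gt_E zp_min] := zero_gtP (ex_intro2 _ _ z2 q_z2 E_z2).
set zm := zero_le q E in le_E zm_max *; set zp := zero_gt q E in gt_E zp_min *.
rewrite leNgt; apply/negP => l_gap.
(* The leftmost window of length [l] that reaches [E] and does not start before [zm]. *)
pose u := Num.max zm (E - l).
have zm_u : zm <= u by rewrite le_max lexx.
have El_u : E - l <= u by rewrite le_max lexx orbT.
have u_E : u <= E by rewrite ge_max le_E /=; lra.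
have ul_zp : u + l <= zp by rewrite -lerBrDr ge_max; apply/andP; split; lra.
have [||z [q_z u_z z_ul]] := window u (u + l); [by lra|by lra|].
have [z_E|E_z] := leP z E.
- by have := zm_max z q_z z_E; lra.
- by have := zp_min z q_z E_z; lra.
Qed.
End NeighboringZeros.

Lemma limn_esup_le_near (R : realType) (f : nat -> R) (C : R) :
  (\forall n \near \oo, f n <= C) -> (limn_esup (fun n => (f n)%:E) <= C%:E)%E.
Proof.
move=> f_le; apply: (@le_trans _ _ (ereal_sup [set (f n)%:E | n in [set n | f n <= C]])).
  by apply: ereal_inf_lbound; exists [set n | f n <= C].
by apply: ge_ereal_sup => _ [n fn <-]; rewrite lee_fin.
Qed.

Theorem theorem8p4 (R : realType) (mu : probability (measurableTypeR R) R)
  (p : nat -> {poly R}) (a b : R) (w : R -> R)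
  (mu_nontrivial : nontrivial_measure mu)
  (mu_compact : compactly_supported mu)
  (p_orthonormal : orthonormal_polys mu p)
  (mu_ac : has_density_on mu a b w)
  (w_lower : 0 < inf [set w x | x in `[a, b]%classic])
  (w_upper : has_ubound [set w x | x in `[a, b]%classic])
  (E : R) (E_int : E \in `]a, b[) :
  [/\ cvg (osc_ratio w E delta @[delta --> 0^'+]),
      (limsup_gap p E <=
        (4 * pi * dist_ends mu E *
          lim (osc_ratio w E delta @[delta --> 0^'+]))%:E)%E
    & {for E, continuous w} ->
      (limsup_gap p E <= (4 * pi * dist_ends mu E)%:E)%E].
Proof.
have bound_gt0 : 0 < 4 * pi * dist_ends mu E.
  rewrite !mulr_gt0 ?pi_gt0 //.
  exact: (dist_ends_gt0 mu_compact mu_ac w_lower w_upper E_int).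
set rho := lim _.
have rho_ge1 : 1 <= rho := lim_osc_ratio_ge1 w_lower w_upper E_int.
have gap_le : (limsup_gap p E <= (4 * pi * dist_ends mu E * rho)%:E)%E.
  apply/lee_addgt0Pr => e e_gt0; rewrite -EFinD; apply: limn_esup_le_near.
  set B := 4 * pi * dist_ends mu E * rho.
  have B_lt : B < B + e by rewrite ltrDl.
  have := zero_in_window mu_nontrivial mu_compact p_orthonormal mu_ac
    w_lower w_upper E_int B_lt.
  apply: filterS => n [n_gt0 window].
  have n_gt0R : 0 < n%:R :> R by rewrite ltr0n.
  have p_neq0 : p n != 0 by rewrite -size_poly_eq0 p_orthonormal.1.
  rewrite mulrC -ler_pdivlMr //; apply: zero_gap_le => //.
  by rewrite divr_gt0 // addr_gt0 // mulr_gt0 //; lra.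
split => //; first exact: cvg_osc_ratio w_lower w_upper E_int.
move=> w_cont; apply: (le_trans gap_le); rewrite lee_fin.
rewrite ler_piMr ?(ltW bound_gt0) //.
exact: lim_osc_ratio_le1 w_lower w_upper E_int w_cont.
Qed.
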